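(* Let $k$ be a positive integer and consider the $k$-th order system of two rational difference equations $$x_n=\frac{\alpha+\sum^{k}_{i=1}\beta_{i}x_{n-i} + \sum^{k}_{i=1}\gamma_{i}y_{n-i}}{A+\sum^{k}_{j=1}B_{j}x_{n-j} + \sum^{k}_{j=1}C_{j}y_{n-j}},\qquad y_n=\frac{p+\sum^{k}_{i=1}\delta_{i}x_{n-i} + \sum^{k}_{i=1}\epsilon_{i}y_{n-i}}{q+\sum^{k}_{j=1}D_{j}x_{n-j} + \sum^{k}_{j=1}E_{j}y_{n-j}},\qquad n\in\mathbb{N},$$ with non-negative real parameters and non-negative initial conditions. Assume that there exist $M_1>0$ and $M_2\ge 0$ such that every solution satisfies $y_n\le M_1x_n+M_2$ for all $n\in\mathbb{N}$. Assume further that $A=0$ and that at least one of the following holds: (i) $I_B\subseteq I_\beta$, $I_C\subseteq I_\gamma$, and $I_B\neq\emptyset$; (ii) $q=0$, $I_D\subseteq I_\delta$, $I_E\subseteq I_\epsilon$, and $I_C\neq\emptyset$; (iii) $p>0$, $q>0$, $I_D\subseteq I_\delta$, $I_E\subseteq I_\epsilon$, and $I_C\neq\emptyset$. Assume moreover that there exists a positive integer $\eta$ such that for every sequence $\{c_m\}_{m=1}^\infty$ with $c_m\in I_\beta\cup(I_\gamma\setminus I_C)$ for all $m\ge 1$ there exist positive integers $N_1,N_2\le\eta$ such that $\sum_{m=N_1}^{N_2}c_m\in I_B$. Then there exist $M>0$ and $N\in\mathbb{N}$ such that every solution (from any non-negative initial conditions) satisfies $x_n\le M$ and $y_n\le M$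 for all $n>N$.
   Context: $\mathbb{N}=\{1,2,\dots\}$. Initial conditions are $x_{1-k},\dots,x_0,y_{1-k},\dots,y_0\ge 0$; a solution is a pair of sequences generated by the system from non-negative initial conditions for which all denominators are positive for every $n\in\mathbb{N}$. For each family of coefficients, the index set is the set of indices in $\{1,\dots,k\}$ with positive coefficient: $I_\beta=\{i:\beta_i>0\}$, $I_\gamma=\{i:\gamma_i>0\}$, $I_\delta=\{i:\delta_i>0\}$, $I_\epsilon=\{i:\epsilon_i>0\}$, $I_B=\{j:B_j>0\}$, $I_C=\{j:C_j>0\}$, $I_D=\{j:D_j>0\}$, $I_E=\{j:E_j>0\}$. A sum $\sum_{m=N_1}^{N_2}$ with $N_1>N_2$ is empty and equals $0$. *)

(* Defs.v *)
From mathcomp Require Import all_boot all_order all_algebra.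
From mathcomp Require Import reals.

Set Implicit Arguments.
Unset Strict Implicit.
Unset Printing Implicit Defensive.

Import Order.TTheory GRing.Theory Num.Theory.
Local Open Scope ring_scope.

(* Coefficient families are functions on nat of which only the values at       *)
(* 1, ..., k matter; sequences are functions on int, of which only the values  *)
(* at indices >= 1 - k matter.                                                 *)

Definition nonneg_coef (R : realType) (k : nat) (a : nat -> R) : Prop :=
  forall i : nat, (1 <= i <= k)%N -> 0 <= a i.

Definition index_set (R : realType) (k : nat) (a : nat -> R) : {pred nat} :=
  [pred i | (1 <= i <= k)%N & 0 < a i].

Definition affine_form (R : realType) (k : nat) (a0 : R) (a b : nat -> R)
    (x y : int -> R) (n : nat) : R :=
  a0 + \sum_(1 <= i < k.+1) a i * x (n%:Z - i%:Z)
     + \sum_(1 <= i < k.+1) b i * y (n%:Z - i%:Z).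

Definition is_solution (R : realType) (k : nat)
    (alpha : R) (beta gamma : nat -> R) (A : R) (B C : nat -> R)
    (p : R) (delta epsilon : nat -> R) (q : R) (D E : nat -> R)
    (x y : int -> R) : Prop :=
  (forall i : nat, (i < k)%N -> 0 <= x (- i%:Z) /\ 0 <= y (- i%:Z)) /\
  (forall n : nat, (1 <= n)%N ->
    [/\ 0 < affine_form k A B C x y n,
        0 < affine_form k q D E x y n,
        x n%:Z = affine_form k alpha beta gamma x y n
                 / affine_form k A B C x y n &
        y n%:Z = affine_form k p delta epsilon x y n
                 / affine_form k q D E x y n]).

(* Main.v *)
(* Each support condition makes x_n (case i) or y_n (cases ii, iii) bounded     *)
(* below, so for n > k the denominator den_n of x_n is at least some d > 0.     *)
(* Terms gamma_i y_{n-i} with C_i > 0 are absorbed by the denominator and the   *)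
(* others by y <= M1 x + M2, whence x_n <= K + L x_{n-i} / den_n, where i       *)
(* maximises x_{n-i} over S = I_beta u (I_gamma \ I_C). Following these         *)
(* maximising indices backwards from n gives a sequence c in S, and some block  *)
(* c_{N1} + ... + c_{N2} equals j in I_B. Across that block x grows at most     *)
(* linearly, while the denominator at its late end is at least                  *)
(* B_j times the value of x at its early end, so x at the late end is bounded   *)
(* by a constant; at most eta further steps lead from there back to x_n.        *)

Require Import Defs.
From mathcomp Require Import all_boot all_order all_algebra.
From mathcomp Require Import reals.
From mathcomp Require Import zify lra.

Set Implicit Arguments.
Unset Strict Implicit.
Unset Printing Implicit Defensive.

Import Order.TTheory GRing.Theory Num.Theory.
Local Open Scope ring_scope.

(** Every constant is fixed before a solution is chosen, so the final bound is uniform.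
    [affine_quotient_ge] yields the lower bound on the denominator, [affine_quotient_le] the
    recursion for x, and [chain_bounded] the backward-chain argument for an abstract recursion. The
    bound on y then comes from y <= M1 x + M2. *)

(** * Comparison of affine forms *)

(** There are only finitely many ratios a_i / b_i, so their absolute sum bounds each of them; the
    summand 1 makes K positive. This turns inclusions of index sets into inequalities. *)
Lemma coef_dominated (R : realType) (k : nat) (a b : nat -> R) :
  nonneg_coef k b -> {subset index_set k a <= index_set k b} ->
  exists2 K, 0 < K & forall i, (1 <= i <= k)%N -> a i <= K * b i.
Proof.
move=> b_ge0 sab.
have S_ge0 : 0 <= \sum_(1 <= i < k.+1) `|a i / b i| by apply: sumr_ge0.
exists (1 + \sum_(1 <= i < k.+1) `|a i / b i|); first by lra.
move=> i ik; case: (ltP 0 (a i)) => [a_gt0|a_le0]; last first.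
  by apply: le_trans a_le0 _; apply: mulr_ge0; [lra | exact: b_ge0].
have /sab : i \in index_set k a by rewrite inE ik.
rewrite inE ik /= => b_gt0; rewrite -ler_pdivrMr //.
apply: le_trans (ler_norm _) _.
rewrite (bigD1_seq i) ?iota_uniq ?mem_index_iota //=.
by rewrite addrCA lerDl addr_ge0 // sumr_ge0.
Qed.

Lemma affine_form_le (R : realType) (k : nat) (a0 a0' : R) (a a' b b' : nat -> R)
    (K : R) (x y : int -> R) (n : nat) :
  (forall i, (1 <= i <= k)%N -> 0 <= x (n%:Z - i%:Z) /\ 0 <= y (n%:Z - i%:Z)) ->
  a0 <= K * a0' ->
  (forall i, (1 <= i <= k)%N -> a i <= K * a' i) ->
  (forall i, (1 <= i <= k)%N -> b i <= K * b' i) ->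
  affine_form k a0 a b x y n <= K * affine_form k a0' a' b' x y n.
Proof.
move=> xy_ge0 le0 lea leb; rewrite /affine_form !mulrDr !mulr_sumr.
apply: lerD; first apply: lerD => //.
all: rewrite big_nat_cond [leRHS]big_nat_cond; apply: ler_sum => i.
all: rewrite andbT ltnS mulrA => ik; have [x0 y0] := xy_ge0 _ ik.
- by apply: ler_wpM2r (lea _ ik).
- by apply: ler_wpM2r (leb _ ik).
Qed.

Lemma le_affine_form (R : realType) (k : nat) (a0 : R) (a b : nat -> R)
    (x y : int -> R) (n j : nat) :
  (forall i, (1 <= i <= k)%N -> 0 <= x (n%:Z - i%:Z) /\ 0 <= y (n%:Z - i%:Z)) ->
  0 <= a0 -> nonneg_coef k a -> nonneg_coef k b -> (1 <= j <= k)%N ->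
  a j * x (n%:Z - j%:Z) + b j * y (n%:Z - j%:Z) <= affine_form k a0 a b x y n.
Proof.
move=> xy_ge0 a0_ge0 a_ge0 b_ge0 jk; rewrite /affine_form.
rewrite -addrA -big_split /= (bigD1_seq j) ?iota_uniq ?mem_index_iota //=.
rewrite addrCA lerDl addr_ge0 // big_nat_cond sumr_ge0 // => i.
rewrite ltnS => /andP[ik _]; have [x0 y0] := xy_ge0 _ ik.
by rewrite addr_ge0 // mulr_ge0 // ?a_ge0 ?b_ge0.
Qed.

Lemma affine_form_ge0 (R : realType) (k : nat) (a0 : R) (a b : nat -> R)
    (x y : int -> R) (n : nat) :
  (forall i, (1 <= i <= k)%N -> 0 <= x (n%:Z - i%:Z) /\ 0 <= y (n%:Z - i%:Z)) ->
  0 <= a0 -> nonneg_coef k a -> nonneg_coef k b ->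
  0 <= affine_form k a0 a b x y n.
Proof.
move=> xy_ge0 a0_ge0 a_ge0 b_ge0; rewrite /affine_form.
rewrite !addr_ge0 // big_nat_cond sumr_ge0 // => i /andP[].
all: rewrite ltnS => ik _; have [x0 y0] := xy_ge0 _ ik.
all: by rewrite mulr_ge0 // ?a_ge0 ?b_ge0.
Qed.

Lemma solution_ge0 (R : realType) (k : nat)
    (alpha : R) (beta gamma : nat -> R) (A : R) (B C : nat -> R)
    (p : R) (delta epsilon : nat -> R) (q : R) (D E : nat -> R)
    (x y : int -> R) :
  (0 < k)%N -> 0 <= alpha -> nonneg_coef k beta -> nonneg_coef k gamma ->
  0 <= p -> nonneg_coef k delta -> nonneg_coef k epsilon ->
  is_solution k alpha beta gamma A B C p delta epsilon q D E x y ->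
  forall n i : nat, (1 <= n)%N -> (1 <= i <= k)%N ->
    0 <= x (n%:Z - i%:Z) /\ 0 <= y (n%:Z - i%:Z).
Proof.
move=> k_gt0 alpha_ge0 beta_ge0 gamma_ge0 p_ge0 delta_ge0 epsilon_ge0 [init rec].
suff nat_ge0 (n : nat) : 0 <= x n%:Z /\ 0 <= y n%:Z.
  move=> n i n_gt0 /andP[i_gt0 ik]; case: (leqP i n) => [le_in|lt_ni].
    by rewrite subzn.
  (* Here n - i = -(i - n), and n >= 1 gives i - n < k, within the range of the initial
     conditions. *)
  by rewrite -opprB subzn 1?ltnW //; apply: init; lia.
elim/ltn_ind: n => -[_|n IH]; first exact: (init 0%N).
have xy_ge0 i : (1 <= i <= k)%N ->
    0 <= x (n.+1%:Z - i%:Z) /\ 0 <= y (n.+1%:Z - i%:Z).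
  move=> /andP[i_gt0 ik]; case: (leqP i n.+1) => [le_in|lt_ni].
    by rewrite subzn //; apply: IH; lia.
  by rewrite -opprB subzn 1?ltnW //; apply: init; lia.
have [xden yden -> ->] := rec n.+1 isT.
by rewrite !divr_ge0 ?(ltW xden) ?(ltW yden) ?affine_form_ge0.
Qed.

(** * Lower and upper bounds for the quotients *)

(** The unprimed form is the denominator. Its support lies in that of the numerator, constant terms
    included, so it is at most a constant multiple of the numerator. *)
Lemma affine_quotient_ge (R : realType) (k : nat) (a0 a0' : R)
    (a a' b b' : nat -> R) :
  nonneg_coef k a' -> nonneg_coef k b' -> 0 <= a0' -> (a0' = 0 -> a0 = 0) ->
  {subset index_set k a <= index_set k a'} ->
  {subset index_set k b <= index_set k b'} ->
  exists2 c, 0 < c & forall (x y : int -> R) (n : nat),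
    (forall i, (1 <= i <= k)%N ->
       0 <= x (n%:Z - i%:Z) /\ 0 <= y (n%:Z - i%:Z)) ->
    0 < affine_form k a0 a b x y n ->
    c <= affine_form k a0' a' b' x y n / affine_form k a0 a b x y n.
Proof.
move=> a'_ge0 b'_ge0 a0'_ge0 a0_eq0 saa' sbb'.
have [K1 K1_gt0 le1] := coef_dominated a'_ge0 saa'.
have [K2 K2_gt0 le2] := coef_dominated b'_ge0 sbb'.
have [K0 K0_gt0 le0] : exists2 K0, 0 < K0 & a0 <= K0 * a0'.
  have [a0'0|a0'_neq0] := eqVneq a0' 0.
    by exists 1 => //; rewrite (a0_eq0 a0'0) a0'0 mulr0.
  have a0'_gt0 : 0 < a0' by rewrite lt_def a0'_neq0.
  exists (1 + `|a0 / a0'|); first by rewrite ltr_wpDr.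
  by rewrite -ler_pdivrMr // (le_trans (ler_norm _)) // lerDr.
have K_gt0 : 0 < K0 + K1 + K2 by rewrite !addr_gt0.
exists (K0 + K1 + K2)^-1; first by rewrite invr_gt0.
move=> x y n xy_ge0 den_gt0; rewrite ler_pdivlMr // ler_pdivrMl //.
apply: affine_form_le => // [|i ik|i ik].
- by apply: le_trans le0 _; rewrite ler_wpM2r //; lra.
- by apply: le_trans (le1 _ ik) _; rewrite ler_wpM2r ?a'_ge0 //; lra.
- by apply: le_trans (le2 _ ik) _; rewrite ler_wpM2r ?b'_ge0 //; lra.
Qed.

Lemma affine_quotient_le (R : realType) (k : nat) (alpha : R)
    (beta gamma : nat -> R) (A : R) (B C : nat -> R) (M1 M2 d : R) :
  0 <= alpha -> nonneg_coef k beta -> nonneg_coef k gamma ->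
  0 <= A -> nonneg_coef k B -> nonneg_coef k C ->
  0 <= M1 -> 0 <= M2 -> 0 < d ->
  exists K L : R, [/\ 0 <= K, 0 <= L & forall (x y : int -> R) (n : nat) (w : R),
    (forall i, (1 <= i <= k)%N ->
       [/\ 0 <= x (n%:Z - i%:Z), 0 <= y (n%:Z - i%:Z) &
           y (n%:Z - i%:Z) <= M1 * x (n%:Z - i%:Z) + M2]) ->
    d <= affine_form k A B C x y n ->
    0 <= w ->
    (forall i, i \in index_set k beta \/
               (i \in index_set k gamma /\ i \notin index_set k C) ->
       x (n%:Z - i%:Z) <= w) ->
    affine_form k alpha beta gamma x y n / affine_form k A B C x y n
      <= K + L * w / affine_form k A B C x y n].
Proof.
move=> alpha_ge0 beta_ge0 gamma_ge0 A_ge0 B_ge0 C_ge0 M1_ge0 M2_ge0 d_gt0.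
(* The part of [gamma] supported in I_C, hence dominated by a multiple of [C]. *)
pose gammaC i := if 0 < C i then gamma i else 0.
have [|Kc Kc_gt0 leC] := @coef_dominated R k gammaC C C_ge0.
  move=> i; rewrite !inE /gammaC.
  by case: ifP; rewrite ?ltxx ?andbF ?andbT // => _ /andP[].
(* After y <= M1 x + M2 and x <= w, [L] collects the coefficients of [w] and [G] the constants. Both
   sums run over all indices, since the surplus terms are non-negative. *)
pose L := \sum_(1 <= i < k.+1) (beta i + M1 * gamma i).
pose G := \sum_(1 <= i < k.+1) gamma i * M2.
have L_ge0 : 0 <= L.
  rewrite /L big_nat_cond sumr_ge0 // => i; rewrite ltnS => /andP[ik _].
  by rewrite addr_ge0 ?mulr_ge0 ?beta_ge0 ?gamma_ge0.
have G_ge0 : 0 <= G.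
  rewrite /G big_nat_cond sumr_ge0 // => i; rewrite ltnS => /andP[ik _].
  by rewrite mulr_ge0 ?gamma_ge0.
have aG_ge0 : 0 <= alpha + G by rewrite addr_ge0.
exists (Kc + (alpha + G) / d), L; split=> //.
  by rewrite addr_ge0 ?divr_ge0 // ltW.
move=> x y n w xy_bd d_le w_ge0 x_le.
have xy_ge0 i : (1 <= i <= k)%N -> 0 <= x (n%:Z - i%:Z) /\ 0 <= y (n%:Z - i%:Z).
  by move=> /xy_bd[].
have den_gt0 := lt_le_trans d_gt0 d_le.
set den := affine_form k A B C x y n in d_le den_gt0 *.
suff num_le : affine_form k alpha beta gamma x y n <=
    Kc * den + (alpha + G) + L * w.
  (* The constant alpha + G is absorbed by [den] using den / d >= 1; the term L * w / den keeps its
     denominator for later use. *)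
  rewrite ler_pdivrMr // [leRHS]mulrDl (divfK (lt0r_neq0 den_gt0)).
  apply: le_trans num_le _; rewrite lerD2r [leRHS]mulrDl lerD2l.
  by rewrite -mulrA ler_peMr // ler_pdivlMl // mulr1.
have den_ge : \sum_(1 <= i < k.+1) C i * y (n%:Z - i%:Z) <= den.
  rewrite /den /affine_form lerDr addr_ge0 // big_nat_cond sumr_ge0 // => i.
  by rewrite ltnS => /andP[ik _]; rewrite mulr_ge0 ?B_ge0 //; case: (xy_ge0 _ ik).
suff sum_le : \sum_(1 <= i < k.+1)
      (beta i * x (n%:Z - i%:Z) + gamma i * y (n%:Z - i%:Z)) <=
    \sum_(1 <= i < k.+1)
      (Kc * (C i * y (n%:Z - i%:Z)) + gamma i * M2 + (beta i + M1 * gamma i) * w).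
  move: sum_le; rewrite !big_split /= -mulr_sumr -/G.
  rewrite -[X in _ <= _ + X -> _]mulr_suml -/L.
  have := ler_wpM2l (ltW Kc_gt0) den_ge; rewrite /affine_form; lra.
rewrite big_nat_cond [leRHS]big_nat_cond ler_sum // => i.
rewrite ltnS => /andP[ik _]; have [x0 y0 y_le] := xy_bd _ ik.
have betax : beta i * x (n%:Z - i%:Z) <= beta i * w.
  case: (ltP 0 (beta i)) => [b_gt0|b_le0].
    by rewrite ler_pM2l // x_le //; left; rewrite inE ik.
  have -> : beta i = 0 by apply/eqP; rewrite eq_le b_le0 beta_ge0.
  by rewrite !mul0r.
have gw_ge0 : 0 <= M1 * gamma i * w by rewrite !mulr_ge0 ?gamma_ge0.
have gM_ge0 : 0 <= gamma i * M2 by rewrite mulr_ge0 ?gamma_ge0.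
have Cy_ge0 : 0 <= Kc * (C i * y (n%:Z - i%:Z)).
  by rewrite !mulr_ge0 ?C_ge0 // ltW.
case: (ltP 0 (C i)) => [C_gt0|C_le0].
  have := leC _ ik; rewrite /gammaC C_gt0 => /(ler_wpM2r y0).
  by rewrite -mulrA; lra.
suff : gamma i * y (n%:Z - i%:Z) <= M1 * gamma i * w + gamma i * M2 by lra.
case: (ltP 0 (gamma i)) => [g_gt0|g_le0]; last first.
  have -> : gamma i = 0 by apply/eqP; rewrite eq_le g_le0 gamma_ge0.
  by rewrite !(mulr0, mul0r) addr0.
rewrite [M1 * _]mulrC -mulrA -mulrDr ler_pM2l // (le_trans y_le) // lerD2r.
rewrite ler_wpM2l // x_le //; right; rewrite !inE ik /= g_gt0.
by rewrite -leNgt C_le0.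
Qed.

(** * Bounding a recursion along backward chains *)

Lemma chain_bounded (R : realType) (k eta : nat) (B : nat -> R) (K L d : R) :
  nonneg_coef k B -> 0 <= K -> 0 <= L -> 0 < d ->
  exists M, forall (u den : nat -> R) (f : nat -> nat),
    (forall n, 0 <= u n) ->
    (forall n, (f n <= k)%N) ->
    (forall n, (k < n)%N -> d <= den n) ->
    (forall n j, (k < n)%N -> j \in index_set k B ->
       B j * u (n - j)%N <= den n) ->
    (forall n, (k < n)%N -> u n <= K + L * u (n - f n)%N / den n) ->
    (forall c : nat -> nat, (forall m, exists n, c m = f n) ->
       exists N1 N2 : nat,
         [/\ (1 <= N1 <= eta)%N, (1 <= N2 <= eta)%N &
             (\sum_(N1 <= m < N2.+1) c m)%N \in index_set k B]) ->
    forall n, (k * eta.+1 < n)%N -> u n <= M.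
Proof.
move=> B_ge0 K_ge0 L_ge0 d_gt0.
(* One [b] serves every j in I_B: compare the indicator of I_B with [B]. *)
have [b b_gt0 leb] : exists2 b, 0 < b & forall j, j \in index_set k B -> 1 <= b * B j.
  have [|b b_gt0 leb] :=
    @coef_dominated R k (fun i => if 0 < B i then 1 else 0) B B_ge0.
    by move=> i; rewrite !inE; case: ifP; rewrite ?ltxx ?andbF ?andbT // => _ /andP[].
  exists b => // j; rewrite inE => /andP[jk B_gt0].
  by have := leb _ jk; rewrite B_gt0.
(* [T] is the factor by which 1 + u can grow in one step, as 1 + K + (L / d) v <= T (1 + v). Since T
   >= 1, at most [eta] steps cost at most T ^+ eta. *)
pose T := 1 + K + L / d.
have Ld_ge0 : 0 <= L / d by rewrite divr_ge0 // ltW.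
have T_ge1 : 1 <= T by rewrite /T; lra.
(* Bounds u at the late end of the block: there [den] dominates both [d] and *)
(* [u / b] evaluated at the early end.                                        *)
pose M' := K + L * (T ^+ eta * (d^-1 + b)).
exists (T ^+ eta * (1 + M')) => u den f u_ge0 f_le den_ge den_B u_le hits n n_gt.
(* [pos m] is the index reached from [n] after m backward steps. *)
have [pos pos0 posS] : exists2 pos : nat -> nat,
    pos 0%N = n & forall m, pos m.+1 = (pos m - f (pos m))%N.
  by exists (fun m => iter m (fun i => i - f i)%N n).
(* Each step goes back by at most k, so starting above k (eta + 1) keeps the first [eta] steps above
   k, where the recursion is valid. *)
have pos_gt m : (m <= eta)%N -> (k * (eta.+1 - m) < pos m)%N.
  elim: m => [|m IH] m_le; first by rewrite pos0 subn0.
  have := IH (ltnW m_le); rewrite posS (subSn (ltnW m_le)) mulnS subSS => ?.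
  by have := f_le (pos m); lia.
have k_lt m : (m <= eta)%N -> (k < pos m)%N.
  move=> m_le; apply: leq_ltn_trans (pos_gt m m_le).
  by rewrite (subSn m_le) mulnS leq_addr.
have step m : (m < eta)%N -> 1 + u (pos m) <= T * (1 + u (pos m.+1)).
  move=> /ltnW/k_lt m_gt; have := u_le _ m_gt; rewrite -posS => le_u.
  have den_gt0 := lt_le_trans d_gt0 (den_ge _ m_gt).
  have v_ge0 := u_ge0 (pos m.+1).
  have : L * u (pos m.+1) / den (pos m) <= L / d * u (pos m.+1).
    rewrite [leRHS]mulrAC ler_wpM2l ?mulr_ge0 // lef_pV2 ?posrE //.
    exact: den_ge.
  rewrite /T; have : 0 <= K * u (pos m.+1) by rewrite mulr_ge0.
  by nra.
have T_pow i : (i <= eta)%N -> T ^+ i <= T ^+ eta by exact: ler_weXn2l.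
have steps m i : (m + i <= eta)%N ->
    1 + u (pos m) <= T ^+ eta * (1 + u (pos (m + i)%N)).
  move=> mi; apply: (@le_trans _ _ (T ^+ i * (1 + u (pos (m + i)%N)))); last first.
    by rewrite ler_wpM2r ?T_pow ?addr_ge0 //; lia.
  elim: i m mi => [|i IH] m mi; first by rewrite addn0 mul1r.
  apply: le_trans (step m _) _; first by lia.
  rewrite exprS -mulrA ler_wpM2l //; first by lra.
  by rewrite addnS -addSn; apply: IH; lia.
have [N1 [N2 [/andP[N1_gt0 N1_le] /andP[N2_gt0 N2_le] jB]]] :
    exists N1 N2 : nat,
      [/\ (1 <= N1 <= eta)%N, (1 <= N2 <= eta)%N &
          (\sum_(N1 <= m < N2.+1) f (pos m.-1))%N \in index_set k B].
  by apply: hits => m; exists (pos m.-1).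
set j := bigop _ _ _ in jB.
(* An empty sum would be 0, which is not in I_B. *)
have le_N : (N1 <= N2)%N.
  by rewrite leqNgt; apply/negP => lt_N; move: jB; rewrite /j big_geq.
have pos_sum a i : (a + i <= eta)%N ->
    (pos (a + i) + \sum_(a.+1 <= m < (a + i).+1) f (pos m.-1))%N = pos a.
  elim: i => [|i IH] ai; first by rewrite addn0 big_geq // addn0.
  have ai' : (a + i <= eta)%N by lia.
  rewrite addnS posS big_nat_recr /=; last by lia.
  rewrite -(IH ai').
  by have := k_lt _ ai'; have := f_le (pos (a + i)%N); lia.
have posj : pos N2 = (pos N1.-1 - j)%N.
  have := @pos_sum N1.-1 (N2 - N1.-1)%N; rewrite subnKC; last by lia.
  by rewrite prednK // -/j; lia.
have k_lt1 : (k < pos N1.-1)%N by apply: k_lt; lia.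
have den_d := den_ge _ k_lt1.
have den_gt0 := lt_le_trans d_gt0 den_d.
(* The denominator at the late end bounds both summands: 1 <= den / d, and u <= b B_j u <= b den. *)
have v_le : 1 + u (pos N2) <= (d^-1 + b) * den (pos N1.-1).
  rewrite mulrDl; apply: lerD; first by rewrite mulrC ler_pdivlMr // mul1r.
  have := den_B _ _ k_lt1 jB; rewrite -posj => le_den.
  apply: (@le_trans _ _ (b * (B j * u (pos N2)))); last by rewrite ler_pM2l.
  by rewrite mulrA ler_peMl // leb.
(* One step of the recursion reaches [pos N1], [steps] reaches [pos N2], and by [v_le] the
   denominator cancels. *)
have mid : u (pos N1.-1) <= M'.
  apply: le_trans (u_le _ k_lt1) _; rewrite -posS prednK // /M' lerD2l.
  rewrite -mulrA ler_wpM2l // ler_pdivrMr // -mulrA.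
  have := @steps N1 (N2 - N1)%N; rewrite subnKC // => /(_ N2_le) le1.
  apply: (@le_trans _ _ (T ^+ eta * (1 + u (pos N2)))); first by lra.
  by rewrite ler_wpM2l // exprn_ge0; lra.
have /(_ _) := @steps 0%N N1.-1; rewrite add0n pos0 => le1.
have {}le1 : 1 + u n <= T ^+ eta * (1 + u (pos N1.-1)) by apply: le1; lia.
apply: (@le_trans _ _ (T ^+ eta * (1 + u (pos N1.-1)))); first by lra.
by rewrite ler_wpM2l ?lerD2l // exprn_ge0; lra.
Qed.

(** * Uniform boundedness of the solutions *)

Theorem theorem17 (R : realType) (k : nat)
    (alpha : R) (beta gamma : nat -> R) (A : R) (B C : nat -> R)
    (p : R) (delta epsilon : nat -> R) (q : R) (D E : nat -> R)
    (k_gt0 : (0 < k)%N)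
    (alpha_ge0 : 0 <= alpha) (beta_ge0 : nonneg_coef k beta)
    (gamma_ge0 : nonneg_coef k gamma)
    (A_ge0 : 0 <= A) (B_ge0 : nonneg_coef k B) (C_ge0 : nonneg_coef k C)
    (p_ge0 : 0 <= p) (delta_ge0 : nonneg_coef k delta)
    (epsilon_ge0 : nonneg_coef k epsilon)
    (q_ge0 : 0 <= q) (D_ge0 : nonneg_coef k D) (E_ge0 : nonneg_coef k E)
    (y_le_x : exists M1 M2 : R, [/\ 0 < M1, 0 <= M2 &
       forall x y : int -> R,
         is_solution k alpha beta gamma A B C p delta epsilon q D E x y ->
         forall n : nat, (1 <= n)%N -> y n%:Z <= M1 * x n%:Z + M2])
    (A_eq0 : A = 0)
    (cases : [\/
       [/\ {subset index_set k B <= index_set k beta},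
           {subset index_set k C <= index_set k gamma} &
           exists j : nat, j \in index_set k B],
       [/\ q = 0,
           {subset index_set k D <= index_set k delta},
           {subset index_set k E <= index_set k epsilon} &
           exists j : nat, j \in index_set k C] |
       [/\ 0 < p, 0 < q,
           {subset index_set k D <= index_set k delta},
           {subset index_set k E <= index_set k epsilon} &
           exists j : nat, j \in index_set k C]])
    (hits_B : exists eta : nat, (1 <= eta)%N /\
       forall c : nat -> nat,
         (forall m : nat, (1 <= m)%N ->
            c m \in index_set k beta \/
            (c m \in index_set k gamma /\ c m \notin index_set k C)) ->
         exists N1 N2 : nat,
           [/\ (1 <= N1 <= eta)%N, (1 <= N2 <= eta)%N &
               (\sum_(N1 <= m < N2.+1) c m)%N \in index_set k B]) :
  exists (M : R) (N : nat), [/\ 0 < M, (1 <= N)%N &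
    forall x y : int -> R,
      is_solution k alpha beta gamma A B C p delta epsilon q D E x y ->
      forall n : nat, (N < n)%N -> x n%:Z <= M /\ y n%:Z <= M].
Proof.
subst A.
have [M1 [M2 [M1_gt0 M2_ge0 y_le]]] := y_le_x.
have [eta [_ hits]] := hits_B.
pose sol := is_solution k alpha beta gamma 0 B C p delta epsilon q D E.
have sol_ge0 x y : sol x y -> forall n i, (1 <= n)%N -> (1 <= i <= k)%N ->
    0 <= x (n%:Z - i%:Z) /\ 0 <= y (n%:Z - i%:Z).
  by move=> sxy; apply: solution_ge0 sxy.
have [d d_gt0 den_ge] : exists2 d, 0 < d & forall x y, sol x y ->
    forall n, (k < n)%N -> d <= affine_form k 0 B C x y n.
  (* For n > k the index n - j is at least 1, so the lower bound on computed terms, not initial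
     values, applies. *)
  have from_B j c : j \in index_set k B -> 0 < c ->
      (forall x y, sol x y -> forall n, (1 <= n)%N -> c <= x n%:Z) ->
      exists2 d, 0 < d & forall x y, sol x y ->
        forall n, (k < n)%N -> d <= affine_form k 0 B C x y n.
    rewrite inE => /andP[jk Bj_gt0] c_gt0 x_ge.
    exists (B j * c) => [|x y sxy n n_gt]; first by rewrite mulr_gt0.
    have n_gt0 : (1 <= n)%N by lia.
    have xy_ge0 i := @sol_ge0 x y sxy n i n_gt0.
    apply: le_trans (le_affine_form xy_ge0 (lexx 0) B_ge0 C_ge0 jk).
    apply: ler_wpDr; first by rewrite mulr_ge0 ?C_ge0 //; case: (xy_ge0 _ jk).
    by rewrite ler_pM2l // subzn ?(x_ge x y) //; lia.
  have from_C j c : j \in index_set k C -> 0 < c ->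
      (forall x y, sol x y -> forall n, (1 <= n)%N -> c <= y n%:Z) ->
      exists2 d, 0 < d & forall x y, sol x y ->
        forall n, (k < n)%N -> d <= affine_form k 0 B C x y n.
    rewrite inE => /andP[jk Cj_gt0] c_gt0 y_ge.
    exists (C j * c) => [|x y sxy n n_gt]; first by rewrite mulr_gt0.
    have n_gt0 : (1 <= n)%N by lia.
    have xy_ge0 i := @sol_ge0 x y sxy n i n_gt0.
    apply: le_trans (le_affine_form xy_ge0 (lexx 0) B_ge0 C_ge0 jk).
    apply: ler_wpDl; first by rewrite mulr_ge0 ?B_ge0 //; case: (xy_ge0 _ jk).
    by rewrite ler_pM2l // subzn ?(y_ge x y) //; lia.
  (* Covers (ii), where q = 0, and (iii), where p > 0 makes the implication vacuous. *)
  have y_case : (p = 0 -> q = 0) -> {subset index_set k D <= index_set k delta} ->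
      {subset index_set k E <= index_set k epsilon} ->
      exists2 c, 0 < c &
        forall x y, sol x y -> forall n, (1 <= n)%N -> c <= y n%:Z.
    move=> pq sD sE.
    have [c c_gt0 c_le] :=
      affine_quotient_ge delta_ge0 epsilon_ge0 p_ge0 pq sD sE.
    exists c => // x y sxy n n_gt0; have [_ den_gt0 _ ->] := sxy.2 n n_gt0.
    by apply: c_le => // i; apply: sol_ge0.
  case: cases => [[sB sC [j jB]]|[q0 sD sE [j jC]]|[p_gt0 _ sD sE [j jC]]].
  - have [c c_gt0 c_le] :=
      affine_quotient_ge beta_ge0 gamma_ge0 alpha_ge0 (fun=> erefl 0) sB sC.
    apply: (from_B j c) => // x y sxy n n_gt0.
    have [den_gt0 _ -> _] := sxy.2 n n_gt0.
    by apply: c_le => // i; apply: sol_ge0.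
  - have [|c c_gt0 c_le] := y_case _ sD sE; first by rewrite q0.
    exact: (from_C j c).
  - have [|c c_gt0 c_le] := y_case _ sD sE; first by lra.
    exact: (from_C j c).
have [K [L [K_ge0 L_ge0 quot_le]]] := affine_quotient_le alpha_ge0 beta_ge0
  gamma_ge0 A_ge0 B_ge0 C_ge0 (ltW M1_gt0) M2_ge0 d_gt0.
pose inS i := (i \in index_set k beta) ||
  ((i \in index_set k gamma) && (i \notin index_set k C)).
have inSP i : inS i -> i \in index_set k beta \/
    (i \in index_set k gamma /\ i \notin index_set k C).
  by case/orP => [|/andP]; [left | right].
have inS_k i : inS i -> (1 <= i <= k)%N.
  by case/orP => [|/andP[+ _]]; rewrite inE => /andP[].
have x_le x y (n : nat) w : sol x y -> (k < n)%N -> 0 <= w ->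
    (forall i, inS i -> x (n%:Z - i%:Z) <= w) ->
    x n%:Z <= K + L * w / affine_form k 0 B C x y n.
  move=> sxy n_gt w_ge0 le_w; have n_gt0 : (1 <= n)%N by lia.
  have [_ _ -> _] := sxy.2 n n_gt0; apply: quot_le => //.
  - move=> i ik; have [] := sol_ge0 x y sxy n i n_gt0 ik; split=> //.
    by rewrite subzn; [apply: (y_le x y sxy); lia | lia].
  - exact: den_ge.
  - by move=> i iS; apply: le_w; apply/orP; case: iS => [|[-> ->]]; [left | right].
have [M M_bound] : exists M, forall x y, sol x y ->
    forall n, (k * eta.+1 < n)%N -> x n%:Z <= M.
  (* If S is empty, w = 0 is admissible and x_n <= K at once. Otherwise [i0] makes the maximum over
     S well defined; the ordinal 0 is excluded by [inS]. *)
  case: (pickP (fun i : 'I_k.+1 => inS i)) => [i0 i0S|noS]; last first.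
    exists K => x y sxy n n_gt.
    have := x_le x y n 0 sxy; rewrite mulr0 mul0r addr0; apply=> //.
      by apply: leq_ltn_trans n_gt; rewrite leq_pmulr.
    move=> i iS; have /andP[_ ik] := inS_k i iS.
    by have := noS (Ordinal (ik : i < k.+1)%N); rewrite iS.
  have [M M_bound] := @chain_bounded R k eta B K L d B_ge0 K_ge0 L_ge0 d_gt0.
  exists M => x y sxy.
  pose argmax n := [arg max_(i > i0 | inS i) x (n%:Z - i%:Z)]%O.
  have argmaxP n : inS (argmax n) /\
      forall i, inS i -> x (n%:Z - i%:Z) <= x (n%:Z - (argmax n)%:Z).
    rewrite /argmax; case: arg_maxP => // i iS i_max; split=> // l lS.
    have /andP[_ lk] := inS_k l lS.
    exact: (i_max (Ordinal (lk : l < k.+1)%N)).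
  have x_ge0 (n : nat) : 0 <= x n%:Z.
    have [] := sol_ge0 x y sxy n.+1 1%N isT; rewrite ?k_gt0 //.
    by rewrite subzn // subn1.
  apply: (M_bound (fun n => x n%:Z) (affine_form k 0 B C x y)
    (fun n => nat_of_ord (argmax n))) => //.
  - by move=> n; rewrite -ltnS.
  - exact: den_ge.
  - move=> n j n_gt; rewrite inE => /andP[jk _]; have n_gt0 : (1 <= n)%N by lia.
    have xy_ge0 i := @sol_ge0 x y sxy n i n_gt0.
    apply: le_trans (le_affine_form xy_ge0 (lexx 0) B_ge0 C_ge0 jk).
    rewrite -subzn; last by lia.
    by rewrite lerDl mulr_ge0 ?C_ge0 //; case: (xy_ge0 _ jk).
  - move=> n n_gt; have [amS am_max] := argmaxP n.
    have am_le : (argmax n <= n)%N by apply: leq_trans (ltnW n_gt); rewrite -ltnS.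
    apply: x_le => //; rewrite -subzn //.
  - by move=> c c_f; apply: hits => m _; have [n ->] := c_f m; apply/inSP/(argmaxP n).1.
(* Here |M| bounds x and M1 |M| + M2 bounds y; the sign of [M] is unknown, and the 1 ensures
   positivity. *)
exists (1 + `|M| + (M1 * `|M| + M2)), (k * eta.+1)%N; split.
- by rewrite -addrA ltr_wpDr // !addr_ge0 // mulr_ge0 // ltW.
- by rewrite muln_gt0 k_gt0.
move=> x y sxy n n_gt; have xM := M_bound _ _ sxy _ n_gt.
have n_gt0 : (1 <= n)%N by lia.
have M_le := ler_norm M; have yn := y_le _ _ sxy _ n_gt0.
have := ler_wpM2l (ltW M1_gt0) (le_trans xM M_le).
have : 0 <= M1 * `|M| by rewrite mulr_ge0 // ltW.
have := normr_ge0 M; lra.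
Qed.
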